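(* There exists a constant $c$ (independent of $m$) such that the following holds. Let $m\ge 1$ be an integer, put $m_0:=\lfloor m/2\rfloor$, and let $P$ be a digital $(0,m,2)$-net over $\mathbb{Z}_2$ whose generating matrices are \[ C_1=I_{m,m},\qquad C_2=\begin{pmatrix} A & B\\ C & D\end{pmatrix}, \] where $I_{m,m}$ is the $m\times m$ identity matrix over $\mathbb{Z}_2$ and $A$ is a nonsingular $m_0\times m_0$ matrix over $\mathbb{Z}_2$ (and $B$, $C$, $D$ are matrices over $\mathbb{Z}_2$ of the appropriate sizes such that $C_1,C_2$ generate a digital $(0,m,2)$-net). Then \[ D^\ast(P)\ge \frac{m}{12}+c . \]
   Context: Digital nets: for $m\times m$ matrices $C_1,C_2$ over $\mathbb{Z}_2$ and $n\in\{0,\dots,2^m-1\}$ with binary digits $n=n_0+n_1 2+\cdots+n_{m-1}2^{m-1}$, set $C_j(n_0,\dots,n_{m-1})^\top=(y^{(j)}_1(n),\dots,y^{(j)}_m(n))^\top$ and $x_n^{(j)}=\sum_{k=1}^m y^{(j)}_k(n)2^{-k}$; the multiset $P=\{\boldsymbol{x}_n=(x_n^{(1)},x_n^{(2)}):0\le n<2^m\}$ is the digital net generated by $C_1,C_2$. It is a digital $(0,m,2)$-net over $\mathbb{Z}_2$ if for all nonnegative integers $d_1,d_2$ with $d_1+d_2=m$, the first $d_1$ rows of $C_1$ together with the first $d_2$ rows of $C_2$ are linearly independent over $\mathbb{Z}_2$. Star discrepancy (unnormalized): for a point set $P$ of $N$ points in $[0,1)^2$, $D^\ast(P)=\sup_J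 |A(J,P)-N\lambda(J)|$, the supremum over all intervals $J=[0,\alpha_1)\times[0,\alpha_2)$ with $0<\alpha_1,\alpha_2\le 1$, where $A(J,P)$ is the number of points of $P$ (counted with multiplicity) lying in $J$ and $\lambda$ is Lebesgue measure. *)

(* Defs.v *)
From HB Require Import structures.
From mathcomp Require Import all_boot all_order all_algebra.
From mathcomp Require Import all_classical all_reals all_analysis.
Set Implicit Arguments.
Unset Strict Implicit.
Unset Printing Implicit Defensive.
Import Order.TTheory GRing.Theory Num.Theory.
Local Open Scope classical_set_scope.
Local Open Scope ring_scope.

Lemma half_split (m : nat) : (m./2 + (m - m./2) = m)%N.
Proof. by apply: subnKC; rewrite -[leqRHS]odd_double_half -addnn addnA leq_addl. Qed.

(* The blocks have row and column sizes (m0, m - m0) with m0 = floor(m/2); the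
   cast only transports the size m0 + (m - m0) to m. *)
Definition half_block_mx (K : Type) (m : nat)
    (A : 'M[K]_(m./2, m./2)) (B : 'M[K]_(m./2, m - m./2))
    (C : 'M[K]_(m - m./2, m./2)) (D : 'M[K]_(m - m./2, m - m./2)) : 'M[K]_m :=
  castmx (half_split m, half_split m) (block_mx A B C D).

(* Least significant digit first; the cast to 'F_2 reduces n %/ 2 ^ i modulo 2. *)
Definition digits (m n : nat) : 'cV['F_2]_m := \col_(i < m) (n %/ 2 ^ i)%:R.

(* Index k : 'I_m counts from 0, hence the weight 2^-(k+1); the entry of the
   product, an element of 'F_2, is read as the natural number 0 or 1. *)
Definition net_coord (R : realType) (m : nat) (C : 'M['F_2]_m) (n : nat) : R :=
  \sum_(k < m) (nat_of_ord ((C *m digits m n) k ord0))%:R / 2 ^+ k.+1.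

(* The multiset of points is represented as a family, so that points are counted
   with multiplicity. *)
Definition digital_net (R : realType) (m : nat) (C1 C2 : 'M['F_2]_m)
    (n : 'I_(2 ^ m)) : R * R :=
  (net_coord R C1 n, net_coord R C2 n).

(* h1 and h2 follow from d1 + d2 = m; they only serve to form the submatrices of
   the first d1 (resp. d2) rows. *)
Definition is_digital_0m2_net (m : nat) (C1 C2 : 'M['F_2]_m) : Prop :=
  forall (d1 d2 : nat) (h1 : (d1 <= m)%N) (h2 : (d2 <= m)%N),
    (d1 + d2 = m)%N ->
    row_free (col_mx (rowsub (widen_ord h1) C1) (rowsub (widen_ord h2) C2)).

Definition box (R : realType) (a : R * R) : set (R * R) :=
  `[0, a.1[%classic `*` `[0, a.2[%classic.

Definition count_in (R : realType) (N : nat) (P : 'I_N -> R * R)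
    (J : set (R * R)) : nat :=
  #|[pred n : 'I_N | P n \in J]|.

Definition star_discrepancy (R : realType) (N : nat) (P : 'I_N -> R * R) : \bar R :=
  ereal_sup [set `| (count_in P (box a))%:R%:E
                    - N%:R%:E * (lebesgue_measure \x lebesgue_measure) (box a) |%E
            | a in [set a : R * R | 0 < a.1 <= 1 /\ 0 < a.2 <= 1]].

(* Main.v *)
(* Let beta = 0.1010... have m0 binary digits. As A is nonsingular there is a point
   n* of the net whose second coordinate starts with the digits of beta and whose
   first coordinate alpha ends with the same digits in reverse order. Cut [0, beta)
   into the dyadic intervals of length 2^-j given by the digits 1 of beta (j odd,
   j <= m0). By the net property, each strip [0, alpha) x (interval j) contains
   floor(2^(m-j) alpha) + 1 points of the net, because the point sharing the first
   m - j digits of alpha differs from n* in the next digit, where alpha has a 1.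
   The excess over the expected number is 1 - {2^(m-j) alpha}, and
   {2^(m-j) alpha} = 0.1010... (j digits) < 2/3. Summing 1/3 over the
   ceil(m0 / 2) odd values of j gives m0 / 6 >= (m - 1) / 12. *)
Require Import Defs.
From mathcomp Require Import all_boot all_order all_algebra.
From mathcomp Require Import all_classical all_reals all_analysis.
From mathcomp Require Import zify lra.
Import Order.TTheory GRing.Theory Num.Theory.
Local Open Scope ring_scope.

(** * Natural numbers given by binary digits *)

(* [msb b m] is the integer with binary digits [b 0 .. b m.-1], most significant
   first, so that [msb b m / 2 ^ m] is the number with expansion 0.b_0 b_1 ... *)
Definition msb (b : nat -> bool) (m : nat) : nat :=
  (\sum_(k < m) b k * 2 ^ (m - k.+1))%N.

Lemma msbS b m : msb b m.+1 = (2 * msb b m + b m)%N.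
Proof.
rewrite /msb big_ord_recr /= subnn expn0 muln1 big_distrr /=; congr addn.
apply: eq_bigr => k _; rewrite subSS -(subnSK (ltn_ord k)) expnS.
by rewrite mulnCA.
Qed.

Lemma msb0 b : msb b 0 = 0%N.
Proof. by rewrite /msb big_ord0. Qed.

Lemma msb_ltn b m : (msb b m < 2 ^ m)%N.
Proof.
elim: m => [|m IH]; first by rewrite msb0.
rewrite msbS expnS; case: (b m); lia.
Qed.

Lemma eq_msb b b' m : (forall k, (k < m)%N -> b k = b' k) -> msb b m = msb b' m.
Proof. by move=> e; apply: eq_bigr => k _; rewrite e. Qed.

Lemma msbD b d j :
  msb b (d + j) = (msb b d * 2 ^ j + msb (fun k => b (d + k)) j)%N.
Proof.
elim: j => [|j IH]; first by rewrite addn0 msb0 muln1 addn0.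
by rewrite addnS !msbS IH expnS; lia.
Qed.

Lemma msb_lt b b' m d : (d < m)%N -> (forall k, (k < d)%N -> b k = b' k) ->
  b d = false -> b' d -> (msb b m < msb b' m)%N.
Proof.
move=> dm e bd b'd; rewrite -(subnKC dm) 2!msbD !msbS (eq_msb _ _ _ e) bd b'd.
have := msb_ltn (fun k => b (d.+1 + k)%N) (m - d.+1); nia.
Qed.

Lemma msb_surj d q : (q < 2 ^ d)%N -> exists b, msb b d = q.
Proof.
elim: d q => [|d IH] q; first by exists xpred0; rewrite msb0; lia.
rewrite expnS => hq; have [|b hb] := IH q./2; first by lia.
exists (fun k => if (k < d)%N then b k else odd q).
rewrite msbS ltnn (eq_msb _ b); last by move=> k ->.
rewrite hb; lia.
Qed.

(** * Digit vectors over ['F_2] and coordinates of the net *)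

Lemma bits_surj m (b : nat -> bool) :
  exists2 n, (n < 2 ^ m)%N & forall i, (i < m)%N -> odd (n %/ 2 ^ i) = b i.
Proof.
elim: m b => [|m IH] b; first by exists 0%N.
have [n hn e] := IH (fun i => b i.+1).
exists (b 0%N + 2 * n)%N; first by rewrite expnS; case: (b 0%N); lia.
case=> [|i] hi; first by rewrite divn1; case: (b 0%N); lia.
rewrite expnS divnMA -e //; congr (odd (_ %/ _)); case: (b 0%N); lia.
Qed.

(** Total on [nat], with value [false] from [m] on, so that digits are compared without casts
    between ordinals. *)
Definition dig (m : nat) (v : 'cV['F_2]_m) (k : nat) : bool :=
  if insub k is Some i then v i ord0 != 0 else false.

Lemma F2_neq0 (x : 'F_2) : x = (x != 0)%:R.
Proof. by apply/val_inj; case: x => [[|[|?]] ?]. Qed.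

Lemma dig_ord m (v : 'cV['F_2]_m) (i : 'I_m) : dig m v i = (v i ord0 != 0).
Proof. by rewrite /dig valK. Qed.

Lemma digE m (v : 'cV['F_2]_m) (i : 'I_m) : v i ord0 = (dig m v i)%:R.
Proof. by rewrite dig_ord -F2_neq0. Qed.

Lemma dig_eqP m (v v' : 'cV['F_2]_m) (i : 'I_m) :
  dig m v i = dig m v' i -> v i ord0 = v' i ord0.
Proof. by rewrite !digE => ->. Qed.

Lemma dig_nat m (v : 'cV['F_2]_m) (i : 'I_m) (b : bool) :
  v i ord0 = b%:R -> dig m v i = b.
Proof. by rewrite dig_ord => ->; case: b. Qed.

Lemma digits_surj m (v : 'cV['F_2]_m) :
  exists n : 'I_(2 ^ m), digits m n = v.
Proof.
have [n hn e] := bits_surj m (dig m v).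
exists (Ordinal hn); apply/colP => i; rewrite mxE digE -e //=.
apply/val_inj; rewrite /= !val_Fp_nat // modn2.
by case: odd.
Qed.

Lemma net_coordE (R : realType) m (M : 'M['F_2]_m) n :
  net_coord R M n = (msb (dig m (M *m digits m n)) m)%:R / 2 ^+ m.
Proof.
rewrite /net_coord /msb natr_sum mulr_suml; apply: eq_bigr => k _.
have -> : nat_of_ord ((M *m digits m n) k ord0) = dig m (M *m digits m n) k.
  by rewrite digE; case: dig.
rewrite natrM natrX -[in 2 ^+ m](subnK (ltn_ord k)) exprD invfM.
by rewrite -!mulrA [_ * (_ / _)]mulrA divff ?mul1r // expf_neq0.
Qed.

(** * Consequences of the net property *)

Section Net.
Variables (m : nat) (M : 'M['F_2]_m).
Hypothesis netM : is_digital_0m2_net 1%:M M.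

(** The selected rows form a square nonsingular system. As the first matrix is the identity, [v]
    itself lists the digits of x. *)
Lemma net_surj d1 d2 (b c : nat -> bool) : (d1 + d2 = m)%N ->
  exists v, (forall k, (k < d1)%N -> dig m v k = b k) /\
            (forall k, (k < d2)%N -> dig m (M *m v) k = c k).
Proof.
move=> e; have h1 : (d1 <= m)%N by lia. have h2 : (d2 <= m)%N by lia.
have /row_freeP[Q] := netM d1 d2 h1 h2 e.
set N := col_mx _ _ => NQ.
pose t : 'cV['F_2]_(d1 + d2) :=
  col_mx (\col_(i < d1) (b i)%:R) (\col_(i < d2) (c i)%:R).
have : N *m (Q *m t) = t by rewrite mulmxA NQ mul1mx.
move: (Q *m t) => v; rewrite /N mul_col_mx => /eq_col_mx[tu td].
exists v; split=> k hk.
  apply: (@dig_nat m v (Ordinal (leq_trans hk h1))).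
  move/colP/(_ (Ordinal hk)): tu; rewrite mul_rowsub_mx mul1mx !mxE => <-.
  by congr (v _ _); apply/val_inj.
apply: (@dig_nat m _ (Ordinal (leq_trans hk h2))).
move/colP/(_ (Ordinal hk)): td; rewrite mul_rowsub_mx [RHS]mxE mxE => <-.
by congr (_ _ _); apply/val_inj.
Qed.

(** Since [d1 + d2 = m], the row-free matrix is also row full and has a left inverse. *)
Lemma net_inj d1 d2 (v v' : 'cV_m) : (d1 + d2 = m)%N ->
  (forall k, (k < d1)%N -> dig m v k = dig m v' k) ->
  (forall k, (k < d2)%N -> dig m (M *m v) k = dig m (M *m v') k) -> v = v'.
Proof.
move=> e e1 e2; have h1 : (d1 <= m)%N by lia. have h2 : (d2 <= m)%N by lia.
have := netM d1 d2 h1 h2 e; set N := col_mx _ _ => freeN.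
have /row_fullP[Q QN] : row_full N.
  by rewrite /row_full -[eqbRHS]e.
suff eN : N *m v = N *m v' by rewrite -(mul1mx v) -QN -mulmxA eN mulmxA QN mul1mx.
rewrite /N !mul_col_mx !mul_rowsub_mx !mul1mx; congr col_mx.
  apply/colP => i; rewrite !mxE; apply: dig_eqP; exact: e1 (ltn_ord i).
apply/colP => i; rewrite mxE [RHS]mxE; apply: dig_eqP; exact: e2 (ltn_ord i).
Qed.

End Net.

(** * The point n* and the block [A] *)

Lemma mul_castmx_col (K : comPzRingType) n m (e : n = m) (M : 'M[K]_n) (v : 'cV_n) :
  castmx (e, e) M *m castmx (e, erefl) v = castmx (e, erefl) (M *m v).
Proof. by case: _ / e; rewrite !castmx_id. Qed.

(** Once the last digits [vb] are fixed, the first ones solve [A *m vt = c - B *m vb]. *)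
Lemma half_block_surj m A B C D (b c : nat -> bool) : A \in unitmx ->
  exists v, (forall k, (m./2 <= k < m)%N -> dig m v k = b k) /\
    (forall k, (k < m./2)%N -> dig m (half_block_mx A B C D *m v) k = c k).
Proof.
move=> uA.
pose vb : 'cV['F_2]_(m - m./2) := \col_i (b (m./2 + i)%N)%:R.
pose vt := invmx A *m ((\col_(i < m./2) (c i)%:R) - B *m vb).
have hm := half_split m.
exists (castmx (half_split m, erefl) (col_mx vt vb)); split=> k hk.
  have km : (k < m)%N by lia.
  have kb : (k - m./2 < m - m./2)%N by lia.
  apply: (@dig_nat m _ (Ordinal km)).
  rewrite castmxE /= (_ : cast_ord _ _ = rshift m./2 (Ordinal kb)); last first.
    by apply/val_inj => /=; lia.
  by rewrite cast_ord_id col_mxEd mxE /= subnKC //; lia.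
have km : (k < m)%N by lia.
apply: (@dig_nat m _ (Ordinal km)).
rewrite /half_block_mx mul_castmx_col castmxE /=.
rewrite (_ : cast_ord _ (Ordinal km) = lshift (m - m./2) (Ordinal hk)); last first.
  by apply/val_inj.
rewrite cast_ord_id mul_block_col col_mxEu mulmxA mulmxV // mul1mx subrK.
by rewrite mxE.
Qed.

(** * The alternating pattern 1010.. *)

(** Digits are indexed from 0: an even [i] is the odd j = i + 1 of the overview. At [i] the number
    [b] has 0 where beta has 1. *)
Lemma msb_even_lt (b : nat -> bool) m m0 i : (i < m0 <= m)%N -> ~~ odd i ->
  (forall k, (k < i)%N -> b k = ~~ odd k) -> b i = false ->
  (msb b m < msb (fun k => ~~ odd k) m0 * 2 ^ (m - m0))%N.
Proof.
move=> /andP[im0 m0m] ei e bi; rewrite -{1}(subnKC m0m) msbD.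
have := msb_lt b (fun k => ~~ odd k) m0 i im0 e bi ei.
have := msb_ltn (fun k => b (m0 + k)%N) (m - m0); nia.
Qed.

(** For even [i] the reversed pattern again reads 10...101, of value (2^(i+2) - 1) / 3. *)
Lemma msb_even_rev i : ~~ odd i ->
  (3 * msb (fun k => ~~ odd (i - k)) i.+1 <= 2 ^ i.+2)%N.
Proof.
move=> /even_halfK <-; elim: i./2 => [|n IH]; first by rewrite msbS msb0.
rewrite doubleS -[n.*2.+3]/(2 + n.*2.+1)%N msbD.
rewrite (eq_msb (fun k => ~~ odd (n.*2.+2 - (2 + k))%N)
  (fun k => ~~ odd (n.*2 - k)%N)) //.
rewrite [msb _ 2]msbS [msb _ 1]msbS msb0 subn0 subSS subn0 /= odd_double /=.
rewrite !expnS in IH *; lia.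
Qed.

Lemma leq_count_even n : (n <= 2 * \sum_(i < n | ~~ odd i) 1)%N.
Proof.
suff -> : (\sum_(i < n | ~~ odd i) 1)%N = uphalf n by lia.
elim: n => [|n IH]; first by rewrite big_ord0.
by rewrite big_mkcond big_ord_recr /= -big_mkcond IH; case: ifP; lia.
Qed.

(** * Counting points strip by strip *)

Section Count.
Variables (m m0 : nat) (M : 'M['F_2]_m) (v : 'cV['F_2]_m).
Hypothesis netM : is_digital_0m2_net 1%:M M.
Hypothesis m0m : (m0 <= m)%N.
Hypothesis vx : forall i, (i < m0)%N -> dig m v (m - i.+1) = ~~ odd i.
Hypothesis vy : forall i, (i < m0)%N -> dig m (M *m v) i = ~~ odd i.

(* When [q] is the prefix of [v] itself, the point sought agrees with [v] in the
   first [m - i.+1] digits of x and [i] digits of y; as it differs from [v] in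
   the next digit of y, the net property makes it differ in the next digit of x
   too, where [v] has a 1. *)
Lemma elementary_point i q : (i < m0)%N -> ~~ odd i ->
  (q <= msb (dig m v) (m - i.+1))%N ->
  exists w, [/\ msb (dig m w) (m - i.+1) = q,
    forall k, (k < i)%N -> dig m (M *m w) k = ~~ odd k,
    dig m (M *m w) i = false &
    (msb (dig m w) m < msb (dig m v) m)%N].
Proof.
move=> im0 ei; set d := (m - i.+1)%N.
have dm : (d + i.+1 = m)%N by rewrite /d; lia.
rewrite leq_eqVlt => /orP[/eqP ->|hq].
  (* [b] copies the first [d] digits of [v] and turns the next one, a 1, into 0. *)
  pose b k := if (k < d)%N then dig m v k else false.
  have [w [wx wy]] := @net_surj m M netM d.+1 i b (fun k => ~~ odd k) ltac:(lia).
  have wb k : (k < d)%N -> dig m w k = dig m v k.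
    by move=> kd; rewrite wx ?/b ?kd //; lia.
  have wd : dig m w d = false by rewrite wx // /b ltnn.
  exists w; split=> //; first exact: eq_msb.
    (* With a 1 at digit [i] of y, [w] would share [d] digits of x and [i.+1] of y with [v], hence
       equal [v]. *)
    apply/negbTE/negP => wi; have vw : w = v.
      apply: (@net_inj m M netM d i.+1) => // k; rewrite ltnS leq_eqVlt.
      case/orP=> [/eqP->|ki]; first by rewrite wi vy.
      by rewrite wy // vy //; lia.
    by move: wd; rewrite vw vx // (negbTE ei).
  by apply: msb_lt wb wd _; rewrite ?vx //; lia.
(* A smaller prefix already puts x below alpha, so digit [i] of y can be prescribed as 0. *)
have [|b qb] := msb_surj d q; first exact: ltn_trans hq (msb_ltn _ _).
have [w [wx wy]] :=
  @net_surj m M netM d i.+1 b (fun k => ~~ odd k && (k < i)%N) dm.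
have wq : msb (dig m w) d = q by rewrite -qb; apply: eq_msb.
exists w; split=> //.
- by move=> k ki; rewrite wy ?ki ?andbT //; lia.
- by rewrite wy // ltnn andbF.
rewrite -[X in (msb _ X < _)%N]dm -[X in (_ < msb _ X)%N]dm 2!msbD wq.
have := msb_ltn (fun k => dig m w (d + k)%N) i.+1; nia.
Qed.

(** A pair (i, q) is recovered from its point: [i] is the first place where y leaves the pattern,
    [q] the prefix of x. Hence the points found are distinct. *)
Lemma count_ge :
  (\sum_(i < m0 | ~~ odd i) (msb (dig m v) (m - i.+1)).+1 <=
   #|[pred n : 'I_(2 ^ m) |
      (msb (dig m (digits m n)) m < msb (dig m v) m) &&
      (msb (dig m (M *m digits m n)) m <
         msb (fun k => ~~ odd k) m0 * 2 ^ (m - m0))]|)%N.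
Proof.
set P := [pred n | _].
pose D := [pred p : 'I_m0 * 'I_(2 ^ m) |
  ~~ odd p.1 && (p.2 < (msb (dig m v) (m - p.1.+1)).+1)%N].
have /choice[h hP] : forall p, exists n : 'I_(2 ^ m), p \in D ->
    [/\ msb (dig m (digits m n)) (m - p.1.+1) = p.2,
    forall k, (k < p.1)%N -> dig m (M *m digits m n) k = ~~ odd k,
    dig m (M *m digits m n) p.1 = false &
    (msb (dig m (digits m n)) m < msb (dig m v) m)%N].
  case=> i q; case: (boolP ((i, q) \in D)) => [|_]; last by exists q.
  rewrite inE /= => /andP[ei qi].
  have [w] := elementary_point i q (ltn_ord i) ei qi.
  by have [n <-] := digits_surj m w; exists n.
have -> : (\sum_(i < m0 | ~~ odd i) (msb (dig m v) (m - i.+1)).+1 = #|D|)%N.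
  rewrite -sum1_card; under [RHS]eq_bigl do rewrite inE.
  rewrite -(pair_big_dep (fun i : 'I_m0 => ~~ odd i)
    (fun (i : 'I_m0) (q : 'I_(2 ^ m)) => q < (msb (dig m v) (m - i.+1)).+1)%N
    (fun _ _ => 1%N)) /=.
  apply: eq_bigr => i _; rewrite -(big_ord_widen _ (fun=> 1%N)).
    by rewrite sum_nat_const card_ord muln1.
  by apply: leq_trans (msb_ltn _ _) _; rewrite leq_exp2l //; lia.
rewrite -(@card_in_imset _ _ h D); last first.
  move=> p p' pD p'D hpp'; have [qp yp zp _] := hP p pD.
  have [] := hP p' p'D; rewrite -hpp' => qp' yp' zp' _.
  have ep : val p.1 = val p'.1.
    case: (ltngtP p.1 p'.1) => [lt|lt|//].
      by move: (yp' _ lt); rewrite zp; case/andP: pD => ->.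
    by move: (yp _ lt); rewrite zp'; case/andP: p'D => ->.
  by apply/eqP; rewrite -pair_eqE /= -!val_eqE /= -qp -qp' ep !eqxx.
apply/subset_leq_card/fintype.subsetP => n /imsetP[p pD ->].
have [_ yp zp xlt] := hP p pD; rewrite inE xlt /=.
by apply: msb_even_lt yp zp; [rewrite ltn_ord m0m|case/andP: pD].
Qed.

Lemma local_discrepancy_ge (R : realType) :
  m0%:R / 6 <= (\sum_(i < m0 | ~~ odd i) (msb (dig m v) (m - i.+1)).+1)%:R
     - 2 ^+ m * ((msb (dig m v) m)%:R / 2 ^+ m *
                 ((msb (fun k => ~~ odd k) m0)%:R / 2 ^+ m0)) :> R.
Proof.
set a := msb (dig m v) m; set c := msb _ m0.
have two_neq0 n : 2 ^+ n != 0 :> R by rewrite expf_neq0.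
rewrite mulrA [2 ^+ m * (_ / _)]mulrCA divff // mulr1.
rewrite [c%:R]natr_sum mulr_suml mulr_sumr.
(* The expected number splits over the strips, one for each digit 1 of beta. *)
have -> : \sum_(i < m0) (a%:R : R) * (((~~ odd i) * 2 ^ (m0 - i.+1))%:R / 2 ^+ m0)
    = \sum_(i < m0 | ~~ odd i) a%:R / 2 ^+ i.+1.
  rewrite [RHS]big_mkcond; apply: eq_bigr => i _.
  case: ifP => _; last by rewrite !mul0n mul0r mulr0.
  rewrite mul1n natrX -[in 2 ^+ m0](subnK (ltn_ord i)) exprD invfM.
  by rewrite [X in _ * X]mulrA divff // mul1r.
rewrite natr_sum -sumrB.
(* At least m0 / 2 even indices contribute 1/3 each. *)
apply: (@le_trans _ _ (\sum_(i < m0 | ~~ odd i) (3^-1 : R))).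
  have := leq_count_even m0; rewrite -(ler_nat R) natrM natr_sum => h.
  have -> : \sum_(i < m0 | ~~ odd i) (3^-1 : R) =
            (\sum_(i < m0 | ~~ odd i) 1) / 3.
    by rewrite mulr_suml; under [RHS]eq_bigr do rewrite mul1r.
  lra.
apply: ler_sum => i ei.
have im := leq_trans (ltn_ord i) m0m.
(* Splits [a / 2 ^+ i.+1] into its integer part, the prefix, and its fractional part, whose digits
   are the reversed pattern by [vx]. *)
have -> : a = (msb (dig m v) (m - i.+1) * 2 ^ i.+1 +
    msb (fun k => dig m v (m - i.+1 + k)%N) i.+1)%N by rewrite -msbD subnK.
rewrite (eq_msb (fun k => dig m v (m - i.+1 + k)%N) (fun k => ~~ odd (i - k)%N)).
  have := msb_even_rev i ei; rewrite -(ler_nat R) expnS !natrM natrX => h.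
  rewrite natrD natrM natrX mulrDl mulfK //.
  set t := _ / _; have : t <= 2 / 3.
    by rewrite ler_pdivrMr ?exprn_gt0 //; lra.
  rewrite -natr1; lra.
move=> k ki; rewrite -vx //; last by have := ltn_ord i; lia.
by congr dig; lia.
Qed.

End Count.

(** * From integer counts to the star discrepancy *)

Lemma star_discrepancy_box (R : realType) N (P : 'I_N -> R * R) (x y : R) :
  0 < x <= 1 -> 0 < y <= 1 ->
  (((count_in P (box (x, y)))%:R - N%:R * (x * y))%:E <= star_discrepancy P)%E.
Proof.
move=> x01 y01; pose e : \bar R :=
  (`| (count_in P (box (x, y)))%:R%:E
      - N%:R%:E * (lebesgue_measure \x lebesgue_measure) (box (x, y)) |)%E.
apply: (@le_trans _ _ e); last first.
  by apply: ereal_sup_ubound; exists (x, y).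
have /andP[x0 _] := x01; have /andP[y0 _] := y01.
rewrite /e {2}/box product_measure1E //= !lebesgue_measure_itv /= !lte_fin x0 y0.
by rewrite !oppr0 !adde0 -!EFinM -EFinD lee_fin ler_norm.
Qed.

Lemma ltr_dyadic (R : realType) (p q i j : nat) : (i <= j)%N ->
  (p%:R / 2 ^+ j < q%:R / 2 ^+ i :> R) = (p < q * 2 ^ (j - i))%N.
Proof.
move=> ij; have two_gt0 k : 0 < 2 ^+ k :> R by rewrite exprn_gt0.
rewrite ltr_pdivrMr // mulrAC -mulrA -[in 2 ^+ j](subnK ij) exprD mulfK ?gt_eqF //.
by rewrite -natrX -natrM ltr_nat.
Qed.

Lemma count_in_net (R : realType) m (M : 'M['F_2]_m) m0 a c : (m0 <= m)%N ->
  count_in (digital_net R 1%:M M) (box (a%:R / 2 ^+ m, c%:R / 2 ^+ m0)) =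
  #|[pred n : 'I_(2 ^ m) | (msb (dig m (digits m n)) m < a)%N &&
      (msb (dig m (M *m digits m n)) m < c * 2 ^ (m - m0))%N]|.
Proof.
move=> m0m; apply: eq_card => n; rewrite !inE.
have x_lt p : (p%:R / 2 ^+ m < a%:R / 2 ^+ m :> R) = (p < a)%N.
  by rewrite ltr_dyadic // subnn muln1.
apply/idP/idP; rewrite in_setE /box /digital_net /= !in_itv /= !net_coordE mul1mx.
  by rewrite x_lt ltr_dyadic // => -[/andP[_ ->] /andP[_ ->]].
case/andP=> ha hc.
by rewrite x_lt ltr_dyadic // ha hc !divr_ge0 ?ler0n ?exprn_ge0.
Qed.

Lemma msb_unit (R : realType) b m : (0 < msb b m)%N ->
  0 < ((msb b m)%:R / 2 ^+ m : R) <= 1.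
Proof.
move=> b0; rewrite divr_gt0 ?ltr0n ?exprn_gt0 //=.
by rewrite ler_pdivrMr ?exprn_gt0 // mul1r -natrX ler_nat ltnW // msb_ltn.
Qed.

Theorem theorem18 (R : realType) :
  exists c : R,
    forall (m : nat) (A : 'M['F_2]_(m./2, m./2)) (B : 'M['F_2]_(m./2, m - m./2))
      (C : 'M['F_2]_(m - m./2, m./2)) (D : 'M['F_2]_(m - m./2, m - m./2)),
      (1 <= m)%N ->
      A \in unitmx ->
      is_digital_0m2_net (1%:M : 'M['F_2]_m) (half_block_mx A B C D) ->
      ((m%:R / 12%:R + c)%:E
        <= star_discrepancy
             (digital_net R (1%:M : 'M['F_2]_m) (half_block_mx A B C D)))%E.
Proof.
(* The constant absorbs the parity of [m]: m <= 2 m0 + 1 gives m/12 - 1/12 <= m0/6. *)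
exists (- 12^-1) => m A B C D m_gt0 uA netM.
set M := half_block_mx A B C D in netM *.
have mE : m%:R <= 2 * m./2%:R + 1 :> R.
  by rewrite -natrM natr1 ler_nat; lia.
have m0m : (m./2 <= m)%N by lia.
have [m00|m0_gt0] := posnP m./2.
  (* Here beta would be 0, which no admissible box allows; the required bound is at most 0 and the
     unit box suffices. *)
  apply: (@le_trans _ _ 0%E).
    by rewrite lee_fin; move: mE; rewrite m00; lra.
  have := star_discrepancy_box R (2 ^ m) (digital_net R 1%:M M) 1 1.
  rewrite ltr01 lexx => /(_ isT isT); apply: le_trans.
  have -> : (1, 1) = ((2 ^ m)%N%:R / 2 ^+ m, 1%:R / 2 ^+ 0) :> R * R.
    by rewrite natrX divff ?expf_neq0 // expr0 divr1.
  rewrite count_in_net // subn0 mul1n lee_fin subr_ge0 !mulr1 ler_nat.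
  by rewrite (eq_card (B := predT)) ?card_ord // => n; rewrite !inE !msb_ltn.
have [v [vx vy]] := half_block_surj m A B C D
  (fun k => ~~ odd (m - k.+1)) (fun k => ~~ odd k) uA.
(* As m0 <= m - m0, the last m0 digits of x are among those prescribed. *)
have {}vx i : (i < m./2)%N -> dig m v (m - i.+1) = ~~ odd i.
  by move=> im; rewrite vx; [congr (~~ odd _)|]; lia.
(* Some point lies strictly to the left of alpha, so alpha > 0. *)
have a_gt0 : (0 < msb (dig m v) m)%N.
  have [w [_ _ _]] := elementary_point m m./2 M v netM m0m vx vy 0 0 m0_gt0 isT isT.
  exact: leq_ltn_trans.
have c_gt0 : (0 < msb (fun k => ~~ odd k) m./2)%N.
  by apply: leq_ltn_trans (msb_lt xpred0 _ _ 0 m0_gt0 _ _ _).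
have := star_discrepancy_box R (2 ^ m) (digital_net R 1%:M M) _ _
  (msb_unit R _ _ a_gt0) (msb_unit R _ _ c_gt0).
apply: le_trans; rewrite lee_fin count_in_net //.
have := count_ge m m./2 M v netM m0m vx vy; rewrite -(ler_nat R).
have := local_discrepancy_ge m m./2 v m0m vx R; rewrite natrX.
lra.
Qed.
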